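(* Let $r\ge 0$ and $\alpha\in[0,1]$. If $S$ is any regular confidence set estimator that verifies the coverage guarantee with statistical resolution $r$ and corruption level $\alpha$, then $$S_{r,\alpha}(\hat{\mathbb P})\subseteq S(\hat{\mathbb P})\qquad\text{for all }\hat{\mathbb P}\in\mathcal P .$$
   Context: Setting. $\Xi$ is a Polish metric space, $\mathcal P$ is the set of all Borel probability distributions on $\Xi$ with the topology of weak convergence. $\Theta$ is an arbitrary parameter set (a Hausdorff topological space) and $\mathcal P_\Theta=\{\mathbb P_\theta:\theta\in\Theta\}\subseteq\mathcal P$ is an arbitrary family of distributions indexed by $\Theta$. Divergences. For $\mathbb P,\mathbb Q\in\mathcal P$, $\mathrm{KL}(\mathbb P,\mathbb Q)=\int\log\frac{d\mathbb P}{d\mathbb Q}\,d\mathbb P$ if $\mathbb P\ll\mathbb Q$ and $+\infty$ otherwise; $\mathrm{TV}(\mathbb P,\mathbb Q)=\inf\{\epsilon>0:\mathbb Q(E)\le\mathbb P(E)+\epsilon,\ \mathbb P(E)\le\mathbb Q(E)+\epsilon\ \text{for all measurable } E\subseteq\Xi\}$. Confidence set estimators. A confidence set estimator is a map $S:\mathcal P\to\{U:U\subseteq\Theta\}$. It is regular if $\mathbb P\mapsto S(\mathbb P)$ is continuous (as a set-valued map, i.e. upper and lower hemicontinuous) and closed-valued. Coverage guarantee. For $\mathbb P^{c}\in\mathcal P$, $\mathbb P_n$ denotes the empirical distribution of $n$ i.i.d. samples from $\mathbb P^{c}$ and $\mathrm{Prob}_{\mathbb P^{c}}$ the corresponding probability.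 $S$ verifies the coverage guarantee with statistical resolution $r\ge0$ and corruption level $\alpha$ if for all $\theta^\star\in\Theta$ and all $\mathbb P^{c}\in\mathcal P$ with $\mathrm{TV}(\mathbb P^{c},\mathbb P_{\theta^\star})\le\alpha$: - if $r>0$: $\limsup_{n\to\infty}\frac1n\log\mathrm{Prob}_{\mathbb P^{c}}(\theta^\star\notin S(\mathbb P_n))<-r$; - if $r=0$: $\limsup_{n\to\infty}\mathrm{Prob}_{\mathbb P^{c}}(\theta^\star\notin S(\mathbb P_n))=0$. DRO (KL-TV) set estimator. $S_{r,\alpha}(\hat{\mathbb P})=\{\theta\in\Theta:\exists\,\mathbb Q\in\mathcal P,\ \mathrm{KL}(\hat{\mathbb P},\mathbb Q)\le r,\ \mathrm{TV}(\mathbb Q,\mathbb P_\theta)\le\alpha\}$. *)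

(* Defs.v *)
From HB Require Import structures.
From mathcomp Require Import all_boot all_order all_algebra.
From mathcomp Require Import all_classical all_reals all_analysis.

Set Implicit Arguments.
Unset Strict Implicit.
Unset Printing Implicit Defensive.

Import Order.TTheory GRing.Theory Num.Theory.
Import numFieldNormedType.Exports.

Local Open Scope classical_set_scope.
Local Open Scope ring_scope.

(* [Complete] and the measurable types carry a base point in the library, so a
   [completeMetricType] is a nonempty complete metric space. *)
#[short(type="completeMetricType")]
HB.structure Definition CompleteMetric (K : numDomainType) :=
  {T of Metric K T & Complete T}.

Definition separable_space (T : topologicalType) : Prop :=
  exists2 D : set T, countable D & dense D.

Definition borel (T : ptopologicalType) := g_sigma_algebraType (@open T).

Definition bounded_continuous (R : realType) (T : topologicalType) : Type :=
  {f : T -> R | continuous f /\ bounded_fun f}.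

HB.instance Definition _ (R : realType) (T : topologicalType) :=
  gen_eqMixin (bounded_continuous R T).

(* The topology of weak convergence: the coarsest one for which
   P |-> \int f dP is continuous for every bounded continuous f. *)
Section weak_convergence.
Context (R : realType) (T : ptopologicalType).

Definition test_integrals (P : probability (borel T) R) :
    {ptws bounded_continuous R T -> R} :=
  fun f => \int[P]_x (sval f x).

HB.instance Definition _ := Topological.copy
  (probability (borel T) R) (initial_topology test_integrals).

End weak_convergence.

Section divergences.
Context d (T : measurableType d) (R : realType).
Implicit Types P Q : probability T R.

(* [lne] sends 0 to -oo and +oo to +oo. The negative part of the integrand is
   always P-integrable, so the integral is never of the form oo - oo. *)
Definition KL P Q : \bar R :=
  if pselect (P `<< Q)
  then (\int[P]_x lne (Radon_Nikodym (charge_of_finite_measure P) Q x))%E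
  else +oo%E.

Definition TV P Q : R :=
  inf [set eps : R | 0 < eps /\ forall E : set T, measurable E ->
    (Q E <= P E + eps%:E)%E /\ (P E <= Q E + eps%:E)%E].

End divergences.

Section sampling.
Context d (T : measurableType d) (R : realType).

Definition tuple_cons n (xs : T * n.-tuple T) : n.+1.-tuple T :=
  [tuple of xs.1 :: xs.2].

Lemma measurable_tuple_cons n : measurable_fun [set: T * n.-tuple T]
  (@tuple_cons n).
Proof. exact: measurable_cons. Qed.

HB.instance Definition _ n := isMeasurableFun.Build _ _ _ _
  (@tuple_cons n) (@measurable_tuple_cons n).

(* The law of n independent draws from P: the n-fold product measure. *)
Fixpoint iid (P : probability T R) n : probability (n.-tuple T) R :=
  match n with
  | 0 => dirac [tuple]
  | m.+1 => distribution (P \x iid P m)%E (@tuple_cons m)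
  end.

Section empirical.
Context (n : nat) (x : n.+1.-tuple T).

Definition empirical : set T -> \bar R :=
  mscale (n.+1%:R^-1)%:nng (msum (fun i => dirac (nth point x i)) n.+1).

HB.instance Definition _ := Measure.on empirical.

Let empirical_setT : empirical [set: T] = 1%E.
Proof.
rewrite /empirical /mscale/= /msum.
rewrite (eq_bigr (fun=> 1%:E)) => [|i _]; last exact: diracT.
rewrite sumEFin -EFinM; congr _%:E.
by rewrite sumr_const card_ord mulVf// pnatr_eq0.
Qed.

HB.instance Definition _ :=
  Measure_isProbability.Build _ _ _ empirical empirical_setT.

End empirical.
End sampling.

Section set_valued.
Context (X Y : topologicalType) (S : X -> set Y).

Definition upper_hemicontinuous : Prop := forall (x : X) (V : set Y),
  open V -> S x `<=` V -> \forall y \near x, S y `<=` V.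

Definition lower_hemicontinuous : Prop := forall (x : X) (V : set Y),
  open V -> S x `&` V !=set0 -> \forall y \near x, S y `&` V !=set0.

End set_valued.

Section confidence_sets.
Context (R : realType) (Xi : ptopologicalType) (Theta : topologicalType).
Local Notation Prob := (probability (borel Xi) R).
Implicit Types (S : Prob -> set Theta) (Pth : Theta -> Prob) (r alpha : R).

Definition regular S : Prop :=
  [/\ upper_hemicontinuous S, lower_hemicontinuous S &
      forall P, closed (S P)].

(* Probability, under n.+1 independent samples from P, that theta is missed. *)
Definition miss_prob S (P : Prob) (theta : Theta) (n : nat) : \bar R :=
  iid P n.+1 [set x | ~ S (empirical R x) theta].

Definition coverage Pth S r alpha : Prop :=
  forall (theta : Theta) (Pc : Prob), TV Pc (Pth theta) <= alpha ->
    (0 < r -> (limn_esup (fun n =>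
       (n.+1%:R^-1)%:E * lne (miss_prob S Pc theta n)) < (- r)%:E)%E) /\
    (r = 0 -> limn_esup (miss_prob S Pc theta) = 0%E).

Definition DRO Pth r alpha (Phat : Prob) : set Theta :=
  [set theta | exists Q : Prob,
     (KL Phat Q <= r%:E)%E /\ TV Q (Pth theta) <= alpha].

End confidence_sets.

(* Main.v *)
Require Import Defs.
From mathcomp Require Import all_boot all_order all_algebra.
From mathcomp Require Import all_classical all_reals all_analysis.
From mathcomp Require Import measurable_realfun ring lra.
Import Order.TTheory GRing.Theory Num.Theory.
Import numFieldNormedType.Exports.
Local Open Scope classical_set_scope.
Local Open Scope ring_scope.
Set Implicit Arguments.
Unset Strict Implicit.

(** Suppose that theta is in the DRO set of Phat, through some Q with
    KL(Phat, Q) <= r and TV(Q, P_theta) <= alpha, but not in S(Phat).  Since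
    points of Theta are closed, upper hemicontinuity of S makes
    U = {P | theta not in S(P)} a weak neighbourhood of Phat.  The distribution Q
    is an admissible corruption of P_theta, so the coverage guarantee applies to
    samples from Q and says that their empirical distribution falls in U with
    probability at most exp(-n s) for some s > r (or tending to 0 when r = 0).
    This is too small: by the lower half of Sanov's theorem that probability
    decays no faster than exp(-n KL(Phat, Q)).

    The Sanov lower bound is obtained by a change of measure.  Under samples from
    Phat itself the event that the empirical distribution is in U has probability
    tending to 1, by the weak law of large numbers applied to finitely many
    bounded continuous functions ([nbhs_concentrates]).  To transfer this to
    samples from Q, the relative entropy is used only through the
    Donsker-Varadhan inequality
      int phi dP <= K + ln (int exp(phi) dQ)    (phi bounded and nonnegative),
    called [entropy_bound] below.  It follows from KL(P, Q) <= K
    ([KL_le_entropy_bound]) and it tensorizes, K becoming n K for n independent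
    draws ([entropy_bound_iid]); in this form the tensorization is an induction
    that uses Tonelli's theorem only, and no density of a product measure ever
    appears.  Taking phi = t 1_B turns it into a comparison of the probabilities
    of an event under the two sampling laws ([entropy_bound_event]):
      t P^n(B) <= n K + ln (1 + exp(t) Q^n(B)).
    With P^n(B) close to 1, Q^n(B) <= exp(-n s) and t = n s this reads
    n s (1 - o(1)) <= n r + ln 2, which is absurd for large n when s > r.

    The estimator S is arbitrary, so the set of samples for which theta is missed
    need not be measurable in the product space.  The argument bounds it from
    below by measurable events, which is legitimate because the sampling law, built
    from iterated integrals, is monotone on all sets ([le_iid]). *)

(** * Integrals of nonnegative functions *)

Section nonnegative_integrals.
Context d (T : measurableType d) (R : realType).

Lemma measurable_lneEFin (h : T -> R) : measurable_fun setT h ->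
  measurable_fun setT (fun x => lne (h x)%:E).
Proof.
move=> mh; rewrite /lne; apply: measurable_fun_ifT.
- exact: measurable_fun_ler.
- exact: measurable_cst.
- apply/measurable_EFinP; apply: measurableT_comp mh; exact: measurable_ln.
Qed.

(** The integral of a nonnegative function is a supremum over the simple functions
    below it, whence monotonicity without any measurability. *)
Lemma ge0_le_integralW (mu : {measure set T -> \bar R}) (f g : T -> \bar R) :
  (forall x, 0 <= f x)%E -> (forall x, f x <= g x)%E ->
  (\int[mu]_x f x <= \int[mu]_x g x)%E.
Proof.
move=> f0 fg; have g0 x : (0 <= g x)%E by exact: le_trans (f0 x) (fg x).
rewrite !ge0_integralTE//; apply: le_ereal_sup => _ [h /= hf <-].
by exists h => //= x; exact: le_trans (hf x) (fg x).
Qed.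

End nonnegative_integrals.

Section bounded_integrals.
Context d (T : measurableType d) (R : realType) (P : probability T R).

Lemma le_integral_bounded (g : T -> R) (M : R) : measurable_fun setT g ->
  (forall x, 0 <= g x <= M) -> (\int[P]_x (g x)%:E <= M%:E)%E.
Proof.
move=> mg gM; apply: (@le_trans _ _ (\int[P]_x (cst M%:E) x)%E).
  by apply: ge0_le_integralW => x; rewrite lee_fin; case/andP: (gM x).
by rewrite integral_cst//= probability_setT mule1.
Qed.

Lemma integral_boundedE (g : T -> R) (M : R) : measurable_fun setT g ->
  (forall x, 0 <= g x <= M) ->
  (\int[P]_x (g x)%:E = (\int[P]_x g x)%:E)%E.
Proof.
move=> mg gM; rewrite fineK// ge0_fin_numE; last first.
  by apply: integral_ge0 => x _; rewrite lee_fin; case/andP: (gM x).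
exact: le_lt_trans (le_integral_bounded mg gM) (ltry _).
Qed.

End bounded_integrals.

(** * The Donsker-Varadhan inequality *)

Section donsker_varadhan.
Context d (T : measurableType d) (R : realType).
Implicit Types P Q : probability T R.

(** The dual form of KL(P, Q) <= K.  The test functions are bounded for
    integrability, and nonnegative so that Tonelli's theorem applies to them and
    the logarithm is nonnegative too. *)
Definition entropy_bound P Q (K : R) := forall (phi : T -> R) (M : R),
  measurable_fun setT phi -> (forall x, 0 <= phi x <= M) ->
  (\int[P]_x (phi x)%:E <= (K + ln (\int[Q]_x expR (phi x)))%:E)%E.

(** With h the density of P with respect to Q and Z = int exp(phi) dQ, the
    inequality 1 + y <= exp(y) at y = phi - ln Z - ln h reads
    1 + phi - ln Z <= ln h + (exp(phi) / Z) / h.  The last term has P-integral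
    at most 1, since integrating against P is integrating against h Q, so
    integrating gives int phi dP - ln Z <= int ln h dP <= K.  The positive and
    negative parts of ln h are kept on separate sides, so that all integrands are
    nonnegative; its negative part is integrable, being at most 1 / h. *)
Lemma KL_le_entropy_bound P Q K : (KL P Q <= K%:E)%E -> entropy_bound P Q K.
Proof.
rewrite /KL; case: pselect => // PQ KLK phi M mphi phiM.
(* This version of the density is nonnegative everywhere, whereas the
   derivative of a charge is so almost everywhere only. *)
pose h x := fine (Radon_Nikodym_SigmaFinite.f P Q x).
have hE x : Radon_Nikodym_SigmaFinite.f P Q x = (h x)%:E.
  by rewrite fineK//; exact: Radon_Nikodym_SigmaFinite.f_fin_num.
have h0 x : 0 <= h x.
  by rewrite -lee_fin -hE; exact: Radon_Nikodym_SigmaFinite.f_ge0.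
have mh : measurable_fun setT h.
  apply/measurable_EFinP; rewrite (_ : _ \o _ = Radon_Nikodym_SigmaFinite.f P Q).
    exact: measurable_int (Radon_Nikodym_SigmaFinite.f_integrable _).
  by apply/funext => x /=; rewrite hE.
have {}KLK : (\int[P]_x lne (h x)%:E <= K%:E)%E.
  apply: le_trans KLK; rewrite le_eqVlt; apply/orP; left; apply/eqP.
  have mRN : measurable_fun setT
      (Radon_Nikodym (charge_of_finite_measure P) Q).
    exact: measurable_int (Radon_Nikodym_integrable _).
  apply: ae_eq_integral => //.
  - exact: measurable_lneEFin.
  - pose k x := fine (Radon_Nikodym (charge_of_finite_measure P) Q x).
    have kE : (fun x => lne (Radon_Nikodym (charge_of_finite_measure P) Q x)) =
        (fun x => lne (k x)%:E).
      by apply/funext => x; rewrite fineK//; exact: Radon_Nikodym_fin_num.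
    rewrite kE; apply: measurable_lneEFin.
    exact: measurableT_comp mRN.
  - apply: (null_dominates_ae_eq measurableT PQ).
    have := @ae_eq_Radon_Nikodym_SigmaFinite _ _ _ P Q PQ setT measurableT.
    by apply: filterS => x /= /[apply] <-; rewrite hE.
have Ph0 : P [set x | h x <= 0] = 0%E.
  have mA : measurable [set x | h x <= 0].
    rewrite -[X in measurable X]setTI; exact: measurable_fun_le.
  rewrite (Radon_Nikodym_SigmaFinite.f_integral PQ mA).
  apply: integral0_eq => x /= hx; rewrite hE.
  by congr EFin; apply/eqP; rewrite eq_le hx h0.
(* [w v] is v / h; writing the inverse through exp and ln makes its
   measurability that of exp and ln. *)
pose w (v : T -> R) x := if h x <= 0 then 0 else v x * expR (- ln (h x)).
have w0 v : (forall x, 0 <= v x) -> forall x, 0 <= w v x.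
  by move=> v0 x; rewrite /w; case: ifP => // _; rewrite mulr_ge0 ?expR_ge0.
have mw v : measurable_fun setT v -> measurable_fun setT (w v).
  move=> mv; apply: measurable_fun_ifT => //; first exact: measurable_fun_ler.
  apply: measurable_funM => //; apply: measurableT_comp => //.
  apply: measurableT_comp => //; apply: measurableT_comp mh.
  exact: measurable_ln.
have intw (v : T -> R) : (forall x, 0 <= v x) -> measurable_fun setT v ->
    (\int[P]_x (w v x)%:E <= \int[Q]_x (v x)%:E)%E.
  move=> v0 mv.
  rewrite -(@Radon_Nikodym_SigmaFinite.change_of_variables _ _ _ _ _ PQ)//.
  - apply: ge0_le_integralW => x.
      by rewrite hE -EFinM lee_fin mulr_ge0// w0.
    rewrite hE -EFinM lee_fin /w; case: ifPn => [_|]; first by rewrite mul0r.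
    by rewrite -ltNge => hx; rewrite expRN lnK ?posrE// divfK// gt_eqF.
  - by move=> x; rewrite lee_fin w0.
  - by apply/measurable_EFinP; exact: mw.
pose l x := lne (h x)%:E.
have ml : measurable_fun setT l by exact: measurable_lneEFin.
have P1 : (\int[P]_x 1 = 1)%E.
  by rewrite (integral_cst _ measurableT 1%E) /= probability_setT mule1.
have Q1 : (\int[Q]_x 1 = 1)%E.
  by rewrite (integral_cst _ measurableT 1%E) /= probability_setT mule1.
have lE x : 0 < h x -> l x = (ln (h x))%:E.
  by move=> hx; rewrite /l /lne leNgt hx.
have aeh : {ae P, forall x, 0 < h x}.
  exists [set x | h x <= 0]; split => //.
    rewrite -[X in measurable X]setTI; exact: measurable_fun_le.
  by move=> x /= /negP; rewrite -leNgt.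
have Ineg : (\int[P]_x l^\- x <= 1)%E.
  rewrite -Q1; apply: le_trans (intw (cst 1) _ _) => //.
  apply: ae_ge0_le_integral => //.
  - by apply: measurable_funeneg.
  - by move=> x _; rewrite lee_fin w0.
  - by apply/measurable_EFinP; exact: mw.
  - apply: filterS aeh => x hx _.
    rewrite funenegE lE// /w (lt_geF hx)/= -EFin_max lee_fin.
    rewrite ge_max mul1r expR_ge0 andbT.
    have := expR_ge1Dx (- ln (h x)); lra.
have Ipos : (\int[P]_x l^\+ x <= K%:E + \int[P]_x l^\- x)%E.
  rewrite -leeBlDr; first by rewrite -integralE.
  by rewrite ge0_fin_numE ?integral_ge0// (le_lt_trans Ineg) ?ltry.
pose Z := \int[Q]_x expR (phi x).
have mexp : measurable_fun setT (fun x => expR (phi x)).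
  exact: measurableT_comp.
have expM x : 0 <= expR (phi x) <= expR M.
  by rewrite expR_ge0 ler_expR; case/andP: (phiM x).
have ZE : (\int[Q]_x (expR (phi x))%:E = Z%:E)%E by exact: integral_boundedE expM.
have Z1 : 1 <= Z.
  rewrite -lee_fin -ZE -Q1; apply: ge0_le_integralW => x; rewrite lee_fin//.
  by rewrite -expR0 ler_expR; case/andP: (phiM x).
have Z0 : 0 < Z by exact: lt_le_trans Z1.
have lnZ0 : 0 <= ln Z by exact: ln_ge0.
pose v x := expR (phi x) / Z.
have mv : measurable_fun setT v.
  by apply: measurable_funM => //; exact: measurable_cst.
have v0 x : 0 <= v x by rewrite divr_ge0 ?expR_ge0// ltW.
have W1 : (\int[P]_x (w v x)%:E <= 1)%E.
  apply: le_trans (intw v v0 mv) _; rewrite /v.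
  under eq_integral do rewrite EFinM muleC.
  rewrite ge0_integralZl_EFin//.
  - by rewrite ZE -EFinM mulVf// gt_eqF.
  - exact/measurable_EFinP.
  - by rewrite invr_ge0 ltW.
have phi0 x : 0 <= phi x by case/andP: (phiM x).
have main : (\int[P]_x ((phi x + 1)%:E + l^\- x) <=
             \int[P]_x (l^\+ x + (w v x + ln Z)%:E))%E.
  apply: ae_ge0_le_integral => //.
  - by move=> x _; rewrite adde_ge0// lee_fin addr_ge0.
  - apply: emeasurable_funD; last exact: measurable_funeneg.
    by apply/measurable_EFinP; exact: measurable_funD.
  - by move=> x _; rewrite adde_ge0// lee_fin addr_ge0// w0.
  - apply: emeasurable_funD; first exact: measurable_funepos.
    by apply/measurable_EFinP; apply: measurable_funD => //; exact: mw.
  - apply: filterS aeh => x hx _.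
    rewrite funenegE funeposE lE// /w (lt_geF hx)/= -!EFin_max -!EFinD lee_fin.
    have := expR_ge1Dx (phi x - ln Z - ln (h x)).
    rewrite expRD expRB (lnK Z0) -/(v x).
    by case: (ltrP (ln (h x)) 0) => ?; case: (ltrP (- ln (h x)) 0) => ?; lra.
move: main.
have -> : (\int[P]_x ((phi x + 1)%:E + l^\- x) =
    \int[P]_x (phi x)%:E + 1 + \int[P]_x l^\- x)%E.
  rewrite ge0_integralD//.
  - congr (_ + _)%E; rewrite -P1 -ge0_integralD//.
    + by move=> x _; rewrite lee_fin.
    + exact/measurable_EFinP.
  - by move=> x _; rewrite lee_fin addr_ge0.
  - by apply/measurable_EFinP; exact: measurable_funD.
  - exact: measurable_funeneg.
have -> : (\int[P]_x (l^\+ x + (w v x + ln Z)%:E) =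
    \int[P]_x l^\+ x + (\int[P]_x (w v x)%:E + (ln Z)%:E))%E.
  rewrite ge0_integralD//.
  - congr (_ + _)%E.
    rewrite -[X in (_ + X)%E]mule1 -[X in (_ * X)%E](probability_setT P).
    rewrite -(integral_cst _ measurableT) -ge0_integralD//.
    + by move=> x _; rewrite lee_fin w0.
    + by apply/measurable_EFinP; exact: mw.
  - exact: measurable_funepos.
  - by move=> x _; rewrite lee_fin addr_ge0// w0.
  - by apply/measurable_EFinP; apply: measurable_funD => //; exact: mw.
rewrite (integral_boundedE P mphi phiM).
have : (0 <= \int[P]_x (w v x)%:E)%E.
  by apply: integral_ge0 => x _; rewrite lee_fin w0.
have : (0 <= \int[P]_x l^\- x)%E by exact: integral_ge0.
have : (0 <= \int[P]_x l^\+ x)%E by exact: integral_ge0.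
move: Ineg Ipos W1.
case: (\int[P]_x l^\- x)%E => // a; case: (\int[P]_x l^\+ x)%E => // b;
  case: (\int[P]_x (w v x)%:E)%E => // c; rewrite -?EFinD !lee_fin; lra.
Qed.
End donsker_varadhan.

(** * Relative entropy of independent samples *)

Section iid_integrals.
Context d (T : measurableType d) (R : realType).
Implicit Types P Q : probability T R.

Lemma integral_iidS P n (F : n.+1.-tuple T -> \bar R) :
  measurable_fun setT F -> (forall z, 0 <= F z)%E ->
  (\int[iid P n.+1]_z F z =
   \int[P]_x \int[iid P n]_y F (tuple_cons (x, y)))%E.
Proof.
move=> mF F0; rewrite ge0_integral_distribution//=.
rewrite fubini_tonelli1//.
apply: measurableT_comp => //; exact: measurable_tuple_cons.
Qed.

Lemma measurable_tuple_consr n (x : T) :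
  measurable_fun setT (fun y : n.-tuple T => tuple_cons (x, y)).
Proof.
apply: measurableT_comp; first exact: measurable_tuple_cons.
exact: measurable_pair1.
Qed.

(** On a measurable set a measure is monotone by additivity; here the sets are
    arbitrary, and monotonicity comes from the iterated integrals that define the
    law of the sample, down to a Dirac mass. *)
Lemma le_iid P n (A B : set (n.-tuple T)) :
  A `<=` B -> (iid P n A <= iid P n B)%E.
Proof.
elim: n A B => [|n IHn] A B AB.
  rewrite /= /dirac /= lee_fin !indicE ler_nat.
  by case: (boolP (_ \in A)) => // /set_mem/AB/mem_set ->.
apply: ge0_le_integralW => x /=; first exact: measure_ge0.
apply: IHn => y; rewrite /xsection /= !inE; exact: AB.
Qed.

(** Integrating out the last n draws replaces exp(phi) by its Q-average Z over
    them.  The induction hypothesis bounds the P-average of phi over these draws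
    by n K + ln Z, and ln Z is again a bounded nonnegative function of the first
    draw, to which the one-draw inequality applies. *)
Lemma entropy_bound_iid P Q K n : 0 <= K -> entropy_bound P Q K ->
  entropy_bound (iid P n) (iid Q n) (n%:R * K).
Proof.
move=> K0 PQK; elim: n => [|n IHn] phi M mphi phiM.
  have mexp : measurable_fun setT (fun x => expR (phi x)).
    exact: measurableT_comp.
  rewrite /= mul0r add0r /Rintegral !integral_dirac//; last 2 first.
    by apply/measurable_EFinP.
    by apply/measurable_EFinP.
  by rewrite !diracT !mul1e/= expRK.
have mexp : measurable_fun setT (fun x => expR (phi x)).
  exact: measurableT_comp.
have expM z : 0 <= expR (phi z) <= expR M.
  by rewrite expR_ge0 ler_expR; case/andP: (phiM z).
have phi0 z : 0 <= phi z by case/andP: (phiM z).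
pose Z x := \int[iid Q n]_y expR (phi (tuple_cons (x, y))).
have mexpx x : measurable_fun setT (fun y => expR (phi (tuple_cons (x, y)))).
  by apply: measurableT_comp mexp _; exact: measurable_tuple_consr.
have ZE x : (\int[iid Q n]_y (expR (phi (tuple_cons (x, y))))%:E = (Z x)%:E)%E.
  exact: (integral_boundedE _ (mexpx x) (fun y => expM _)).
have Z1 x : 1 <= Z x.
  rewrite -lee_fin -ZE -[leLHS]mule1 -[X in (_ * X)%E](probability_setT (iid Q n)).
  rewrite -integral_cst//; apply: ge0_le_integralW => y; rewrite lee_fin//.
  by rewrite -expR0 ler_expR.
have ZM x : Z x <= expR M.
  by rewrite -lee_fin -ZE; exact: (le_integral_bounded _ (mexpx x) (fun y => expM _)).
have Z0 x : 0 < Z x by exact: lt_le_trans (Z1 x).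
have mZ : measurable_fun setT Z.
  apply/measurable_EFinP.
  rewrite (_ : _ \o _ = fubini_F (iid Q n)
      (fun z => (expR (phi (tuple_cons z)))%:E)); last first.
    by apply/funext => x /=; rewrite -ZE.
  apply: measurable_fun_fubini_tonelli_F => [|z]; last by rewrite lee_fin expR_ge0.
  apply/measurable_EFinP; apply: measurableT_comp mexp _.
  exact: measurable_tuple_cons.
have mlnZ : measurable_fun setT (fun x => ln (Z x)).
  by apply: measurableT_comp mZ; exact: measurable_ln.
have lnZM x : 0 <= ln (Z x) <= M.
  by rewrite ln_ge0//= -[leRHS]expRK ler_ln ?posrE// ?expR_gt0.
rewrite integral_iidS//; last first.
  exact/measurable_EFinP.
apply: (@le_trans _ _ (\int[P]_x ((n%:R * K)%:E + (ln (Z x))%:E))%E).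
  apply: ge0_le_integralW => x.
    by apply: integral_ge0 => y _; rewrite lee_fin.
  rewrite -EFinD; apply: (IHn _ M) => [|y]; last exact: phiM.
  by apply: measurableT_comp mphi _; exact: measurable_tuple_consr.
rewrite ge0_integralD//; last 3 first.
- by move=> x _; rewrite lee_fin mulr_ge0.
- by move=> x _; rewrite lee_fin; case/andP: (lnZM x).
- exact/measurable_EFinP.
rewrite integral_cst//= probability_setT mule1.
rewrite -natr1 mulrDl mul1r -addrA EFinD leeD2l//.
apply: le_trans (PQK _ _ mlnZ lnZM) _.
rewrite lee_fin lerD2l le_eqVlt; apply/orP; left; apply/eqP; congr ln.
rewrite /Rintegral integral_iidS//.
- by congr fine; apply: eq_integral => x _; rewrite ZE lnK ?posrE.
- exact/measurable_EFinP.
Qed.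

End iid_integrals.

Section bounds_on_events.
Context d (T : measurableType d) (R : realType).
Implicit Types P Q : probability T R.

(** The inequality for phi = t 1_B, with exp(t 1_B) <= 1 + exp(t) 1_B. *)
Lemma entropy_bound_event P Q K (B : set T) (t p q : R) :
  entropy_bound P Q K -> measurable B -> 0 <= t ->
  (p%:E <= P B)%E -> (Q B <= q%:E)%E ->
  t * p <= K + ln (1 + expR t * q).
Proof.
move=> PQK mB t0 pP Qq.
have mphi : measurable_fun setT (fun x => t * \1_B x) by exact: measurable_funM.
have phiM x : 0 <= t * \1_B x <= t.
  by rewrite indicE mulr_ge0 ?ler0n//= -[leRHS]mulr1 ler_wpM2l// lern1 leq_b1.
have mexp : measurable_fun setT (fun x => expR (t * \1_B x)).
  exact: measurableT_comp.
have expM x : 0 <= expR (t * \1_B x) <= expR t.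
  by rewrite expR_ge0 ler_expR; case/andP: (phiM x).
rewrite -lee_fin; apply: (@le_trans _ _ (\int[P]_x (t * \1_B x)%:E)%E).
  under eq_integral do rewrite EFinM.
  rewrite ge0_integralZl_EFin//; last exact/measurable_EFinP.
  by rewrite integral_indic// setIT EFinM lee_wpmul2l// lee_fin.
apply: le_trans (PQK _ _ mphi phiM) _.
rewrite lee_fin lerD2l.
have le_int : \int[Q]_x expR (t * \1_B x) <= 1 + expR t * q.
  rewrite -lee_fin -(integral_boundedE Q mexp expM).
  apply: (@le_trans _ _ (\int[Q]_x (1 + (expR t)%:E * (\1_B x)%:E))%E).
    apply: ge0_le_integralW => x; first by rewrite lee_fin expR_ge0.
    rewrite -EFinM lee_fin indicE; case: (_ \in _) => /=.
      by rewrite !mulr1 lerDr.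
    by rewrite !mulr0 expR0 addr0.
  have mB1 : measurable_fun setT (fun x => (\1_B x : R)%:E).
    exact/measurable_EFinP.
  rewrite ge0_integralD//; last exact: measurable_funeM.
  rewrite integral_cst//= probability_setT mule1 EFinD leeD2l//.
  rewrite ge0_integralZl_EFin// ?expR_ge0//.
  by rewrite integral_indic// setIT EFinM lee_wpmul2l// lee_fin expR_ge0.
have int0 : 0 < \int[Q]_x expR (t * \1_B x).
  rewrite -lte_fin -(integral_boundedE Q mexp expM).
  apply: (@lt_le_trans _ _ (\int[Q]_x cst 1 x)%E).
    by rewrite integral_cst//= probability_setT mule1.
  apply: ge0_le_integralW => x //=; rewrite lee_fin -expR0 ler_expR.
  by case/andP: (phiM x).
by rewrite ler_ln// posrE// (lt_le_trans int0).
Qed.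

Lemma markov_event P (F : T -> R) (B : set T) (c : R) :
  measurable_fun setT F -> (forall x, 0 <= F x) -> measurable B -> 0 <= c ->
  (forall x, B x -> c <= F x) -> (c%:E * P B <= \int[P]_x (F x)%:E)%E.
Proof.
move=> mF F0 mB c0 cF.
rewrite -[B]setIT -integral_indic// -ge0_integralZl_EFin//; last first.
  exact/measurable_EFinP.
apply: ge0_le_integralW => x; first by rewrite mule_ge0.
rewrite -EFinM lee_fin indicE; case: (boolP (_ \in _)) => [/set_mem Bx|_].
  by rewrite mulr1 cF.
by rewrite mulr0.
Qed.

End bounds_on_events.

(** * The weak law of large numbers *)

Section empirical_mean.
Context d (T : measurableType d) (R : realType).
Implicit Types P Q : probability T R.

Definition tuple_sum n (f : T -> R) (x : n.-tuple T) : R := \sum_(y <- x) f y.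

Lemma measurable_tuple_sum n (f : T -> R) : measurable_fun setT f ->
  measurable_fun setT (@tuple_sum n f).
Proof.
move=> mf.
rewrite (_ : @tuple_sum n f = fun x => \sum_(i < n) f (tnth x i)); last first.
  by apply/funext => x; rewrite /tuple_sum big_tuple.
apply: measurable_sum => i; apply: measurableT_comp mf _.
exact: measurable_tnth.
Qed.

Lemma tuple_sum_cons n (f : T -> R) x (y : n.-tuple T) :
  tuple_sum f (tuple_cons (x, y)) = f x + tuple_sum f y.
Proof. by rewrite /tuple_sum big_cons. Qed.

(** The shift c makes the induction go through: the first draw is absorbed in c,
    so only integrals of nonnegative functions over the product are needed, and
    no covariance. *)
Lemma second_moment P n (g : T -> R) (c C : R) :
  measurable_fun setT g -> (forall x, `|g x| <= C) -> \int[P]_x g x = 0 ->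
  (\int[iid P n]_x ((c + tuple_sum g x) ^+ 2)%:E <=
   (c ^+ 2 + n%:R * C ^+ 2)%:E)%E.
Proof.
move=> mg gC g0; have intg : P.-integrable setT (EFin \o g).
  apply: (@le_integrable _ _ _ _ _ _ _ (cst C%:E)) => //=.
  - exact/measurable_EFinP.
  - by move=> x _; rewrite lee_fin (le_trans (gC x))// ler_norm.
  - exact: finite_measure_integrable_cst.
elim: n c => [|n IHn] c.
  have mS := measurable_tuple_sum (n := 0) mg.
  rewrite /= integral_dirac//; last first.
    by apply/measurable_EFinP; apply: measurable_funX; exact: measurable_funD.
  by rewrite diracT mul1e /tuple_sum big_nil addr0 mul0r addr0.
have mS := measurable_tuple_sum (n := n.+1) mg.
rewrite integral_iidS; last 2 first.
- by apply/measurable_EFinP; apply: measurable_funX; exact: measurable_funD.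
- by move=> z; rewrite lee_fin sqr_ge0.
apply: (@le_trans _ _ (\int[P]_x ((c + g x) ^+ 2 + n%:R * C ^+ 2)%:E)%E).
  apply: ge0_le_integralW => x.
    by apply: integral_ge0 => y _; rewrite lee_fin sqr_ge0.
  apply: le_trans (IHn _); rewrite le_eqVlt; apply/orP; left; apply/eqP.
  by apply: eq_integral => y _; rewrite tuple_sum_cons addrA.
(* The cross term 2 c g is the only one that is not of constant sign; it
   integrates to 0. *)
pose k := c ^+ 2 + n.+1%:R * C ^+ 2.
apply: (@le_trans _ _ (\int[P]_x (k + (c * 2) * g x)%:E)%E).
  apply: ge0_le_integralW => x; rewrite lee_fin.
    by rewrite addr_ge0 ?sqr_ge0// mulr_ge0// sqr_ge0.
  have : g x ^+ 2 <= C ^+ 2.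
    rewrite -[leLHS]real_normK ?num_real// lerXn2r// ?nnegrE//.
    exact: le_trans (gC x).
  rewrite /k -natr1; lra.
under eq_integral do rewrite EFinD EFinM.
rewrite integralD//; last 2 first.
- exact: finite_measure_integrable_cst.
- exact: integrableZl.
rewrite integral_cst//= probability_setT mule1 integralZl//.
have -> : (\int[P]_x (g x)%:E = 0)%E.
  rewrite -[LHS]fineK; first by rewrite -[X in X%:E]/(\int[P]_x g x) g0.
  exact: integrable_fin_num intg.
by rewrite mule0 adde0.
Qed.

Lemma integral_empirical n (x : n.+1.-tuple T) (f : T -> R) :
  measurable_fun setT f ->
  (\int[empirical R x]_y (f y)%:E = (n.+1%:R^-1 * tuple_sum f x)%:E)%E.
Proof.
move=> mf.
have pos (g : T -> \bar R) : measurable_fun setT g -> (forall y, 0 <= g y)%E ->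
  (\int[empirical R x]_y g y =
   (n.+1%:R^-1)%:E * \sum_(y <- x) g y)%E.
  move=> mg g0; rewrite ge0_integral_mscale// ge0_integral_measure_sum//.
  congr (_ * _)%E.
  rewrite (big_nth point) size_tuple big_mkord; apply: eq_bigr => i _.
  by rewrite integral_dirac// diracT mul1e.
have mEf : measurable_fun setT (fun y => (f y)%:E) by exact/measurable_EFinP.
rewrite integralE !pos//; [|exact: measurable_funeneg|exact: measurable_funepos].
have posE : (\sum_(y <- x) (fun y => (f y)%:E)^\+ y =
    (\sum_(y <- x) Num.max (f y) 0)%:E)%E.
  by rewrite -sumEFin; apply: eq_bigr => y _; rewrite funeposE -EFin_max.
have negE : (\sum_(y <- x) (fun y => (f y)%:E)^\- y =
    (\sum_(y <- x) Num.max (- f y) 0)%:E)%E.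
  by rewrite -sumEFin; apply: eq_bigr => y _; rewrite funenegE -EFin_max.
rewrite posE negE -!EFinM -EFinB -mulrBr -sumrB; congr (_ * _)%:E.
apply: eq_bigr => y _; case: (ltrP (f y) 0) => ?; case: (ltrP (- f y) 0) => ?; lra.
Qed.

(** Chebyshev's inequality, with the crude variance bound (C + |mean|)^2. *)
Lemma weak_law P n (f : T -> R) (C eps : R) :
  measurable_fun setT f -> (forall x, `|f x| <= C) -> 0 < eps ->
  let B := [set x : n.+1.-tuple T |
    eps <= `|n.+1%:R^-1 * tuple_sum f x - \int[P]_x f x|] in
  measurable B /\
  (iid P n.+1 B <=
    ((C + `|\int[P]_x f x|) ^+ 2 / eps ^+ 2 * n.+1%:R^-1)%:E)%E.
Proof.
move=> mf fC eps0 B.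
set m := \int[P]_x f x in B *.
have intf : P.-integrable setT (EFin \o f).
  apply: (@le_integrable _ _ _ _ _ _ _ (cst C%:E)) => //=.
  - exact/measurable_EFinP.
  - by move=> x _; rewrite lee_fin (le_trans (fC x))// ler_norm.
  - exact: finite_measure_integrable_cst.
pose g x := f x - m.
have mg : measurable_fun setT g by exact: measurable_funB.
have gC x : `|g x| <= C + `|m| by rewrite (le_trans (ler_normB _ _))// lerD2r.
have g0 : \int[P]_x g x = 0.
  rewrite RintegralB//; last exact: finite_measure_integrable_cst.
  by rewrite Rintegral_cst//= probability_setT mulr1 subrr.
have mS := measurable_tuple_sum (n := n.+1) mg.
have BE : B = [set x | eps * n.+1%:R <= `|tuple_sum g x|].
  apply/funext => x; rewrite /B /=; congr is_true.
  have -> : tuple_sum g x = n.+1%:R * (n.+1%:R^-1 * tuple_sum f x - m).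
    rewrite /tuple_sum sumrB big_const_seq count_predT size_tuple iter_addr_0.
    by rewrite mulrBr mulVKf ?pnatr_eq0// mulr_natl.
  by rewrite normrM (ger0_norm (ler0n _ _)) [eps * _]mulrC ler_pM2l.
have mB : measurable B.
  rewrite BE -[X in measurable X]setTI; apply: measurable_fun_le => //.
  exact: measurableT_comp.
split => //.
have en0 : 0 < (eps * n.+1%:R) ^+ 2 by rewrite exprn_gt0// mulr_gt0.
have mS2 : measurable_fun setT (fun x : n.+1.-tuple T => (0 + tuple_sum g x) ^+ 2).
  by apply: measurable_funX; exact: measurable_funD.
have := second_moment n.+1 0 mg gC g0.
move/(le_trans (markov_event (iid P n.+1) mS2 (fun=> sqr_ge0 _) mB (ltW en0) _)).
have HB x : B x -> (eps * n.+1%:R) ^+ 2 <= (0 + tuple_sum g x) ^+ 2.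
  rewrite BE /= => Bx; rewrite add0r -[leRHS]real_normK ?num_real//.
  by rewrite lerXn2r// nnegrE mulr_ge0// ltW.
move=> /(_ HB); rewrite expr0n/= add0r.
rewrite -lee_pdivlMl// -EFinM => /le_trans; apply; rewrite lee_fin le_eqVlt.
by apply/orP; left; apply/eqP; field; rewrite nat1r pnatr_eq0 /= gt_eqF.
Qed.
End empirical_mean.

(** * Concentration of the empirical distribution in weak neighbourhoods *)

Section weak_concentration.
Context (R : realType) (Xi : ptopologicalType).
Local Notation Prob := (probability (borel Xi) R).
Implicit Types (P : Prob) (U : set Prob).

Lemma continuous_borel_measurable (f : Xi -> R) :
  continuous f -> measurable_fun [set: borel Xi] f.
Proof.
move=> /continuousP cf; apply: (measurability _ (RGenOpens.measurableE R)).
move=> _ [_ [a [b ->] <-]]; rewrite setTI; apply: sub_sigma_algebra.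
exact/cf/interval_open.
Qed.

(** As U is an arbitrary set, the event that the empirical distribution falls
    outside U is only required to be covered by measurable events whose
    probability vanishes. *)
Definition concentrates P U := exists B : forall n, set (n.+1.-tuple (borel Xi)),
  [/\ forall n, measurable (B n),
      forall n x, ~ B n x -> U (empirical R x) &
      (fun n => iid P n.+1 (B n)) @ \oo --> 0%E].

Lemma concentrates_filter P : Filter (concentrates P).
Proof.
split.
- exists (fun=> set0); split => //.
  rewrite (_ : (fun n => _) = cst 0%E); first exact: cvg_cst.
  by apply/funext => n; exact: measure0.
- move=> U V [A [mA AU A0]] [B [mB BV B0]]; exists (fun n => A n `|` B n); split.
  + by move=> n; apply: measurableU; [exact: mA|exact: mB].
  + by move=> n x /not_orP[nA nB]; split; [exact: AU|exact: BV].
  + apply: (@squeeze_cvge _ _ _ _ (fun=> 0%E) _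
      (fun n => iid P n.+1 (A n) + iid P n.+1 (B n))%E).
    * apply: nearW => n; rewrite measure_ge0/=.
      exact: (measureU2 (iid P n.+1) (mA n) (mB n)).
    * exact: cvg_cst.
    * by rewrite -[0%E in X in _ --> X]adde0; apply: cvgeD.
- move=> U V UV [A [mA AU A0]]; exists A; split => // n x nA; exact/UV/AU.
Qed.

Lemma concentrates_mean P (f : bounded_continuous R Xi) (W : set R) :
  nbhs (test_integrals P f) W ->
  concentrates P [set P' | W (test_integrals P' f)].
Proof.
case/nbhs_ballP => eps /= eps0 epsW.
case: (svalP f) => cf [C0 [_ bf]].
pose g : borel Xi -> R := sval f.
have mf : measurable_fun setT g.
  exact: continuous_borel_measurable.
pose C := C0 + 1.
have fC x : `|g x| <= C by apply: bf => //; rewrite ltrDl.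
exists (fun n => [set x : n.+1.-tuple (borel Xi) |
  eps <= `|n.+1%:R^-1 * tuple_sum g x - \int[P]_x g x|]); split.
- by move=> n; have [] := weak_law P n mf fC eps0.
- move=> n x /= /negP; rewrite -ltNge => xe; apply: epsW.
  rewrite /ball /= distrC /test_integrals.
  rewrite [X in `|X - _|](_ : _ = n.+1%:R^-1 * tuple_sum g x)//.
  by rewrite /Rintegral integral_empirical.
- set K := ((C + `|\int[P]_x g x|) ^+ 2 / eps ^+ 2).
  apply: (@squeeze_cvge _ _ _ _ (fun=> 0%E) _ (fun n => (K * n.+1%:R^-1)%:E)).
  + apply: nearW => n; rewrite measure_ge0/=.
    by have [] := weak_law P n mf fC eps0.
  + exact: cvg_cst.
  + apply: cvg_EFin; first exact: nearW.
    rewrite -[0 in X in _ --> X](mulr0 K); apply: cvgMr.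
    exact: cvg_harmonic.
Qed.

(** The sets in which the empirical distribution concentrates form a filter, so
    it is enough to see that this filter converges to P.  The weak topology being
    initial for the test integrals, convergence is checked on one test function
    at a time, where it is the weak law of large numbers. *)
Lemma nbhs_concentrates P U : nbhs P U -> concentrates P U.
Proof.
have FF := concentrates_filter P.
move=> [_ [[B oB <-] /= BP BU]].
pose G : set_system {ptws bounded_continuous R Xi -> R} :=
  [set W | concentrates P (@test_integrals R Xi @^-1` W)].
have FG : Filter G.
  split.
  - exact: (@filterT _ _ FF).
  - by move=> V W; exact: (@filterI _ _ FF).
  - by move=> V W VW; apply: (@filterS _ _ FF) => P'; exact: VW.
suff : G --> test_integrals P.
  move=> /(_ B) GB; apply: (@filterS _ _ FF _ _ BU).
  by apply: GB; exact: open_nbhs_nbhs.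
apply/cvg_sup => f W [_ [[V oV <-] /= VP VW]].
apply: (@filterS _ _ FG _ _ VW).
apply: concentrates_mean.
exact: open_nbhs_nbhs.
Qed.

End weak_concentration.

Lemma limn_esup_lt (R : realType) (u : (\bar R)^nat) (c : \bar R) :
  (limn_esup u < c)%E -> \forall n \near \oo, (u n < c)%E.
Proof.
rewrite /limn_esup limf_esupE => /ereal_inf_lt[_ [V VF <-] Vc].
apply: filterS VF => n Vn; apply: le_lt_trans Vc; apply: ereal_sup_ubound.
by exists n.
Qed.

(** * Sanov's lower bound and the optimality of the DRO estimator *)

Section change_of_measure.
Context (R : realType) (Xi : ptopologicalType).
Local Notation Prob := (probability (borel Xi) R).
Implicit Types (P Q : Prob) (U : set Prob).

(** Sanov's lower bound before optimization over t: q stands for an upper bound of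
    the Q-probability that the empirical distribution is in U, and p for any
    number below the limit 1 of its P-probability. *)
Lemma entropy_bound_nbhs P Q K U : 0 <= K -> entropy_bound P Q K ->
  nbhs P U -> forall p : R, p < 1 -> \forall n \near \oo, forall t q : R,
    0 <= t ->
    (iid Q n.+1 [set x | U (empirical R x)] <= q%:E)%E ->
    t * p <= n.+1%:R * K + ln (1 + expR t * q).
Proof.
move=> K0 PQK /nbhs_concentrates[B [mB BU B0]] p p1.
have p10 : (0 < (1 - p)%:E :> \bar R)%E by rewrite lte_fin subr_gt0.
have : \forall n \near \oo, (iid P n.+1 (B n) < (1 - p)%:E)%E.
  apply: limn_esup_lt; rewrite is_cvg_limn_esupE; last exact: cvgP B0.
  by rewrite (cvg_lim _ B0).
apply: filterS => n Bn t q t0 Uq.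
apply: (entropy_bound_event (P := iid P n.+1) (Q := iid Q n.+1)
  (B := ~` B n)) => //.
- exact: entropy_bound_iid.
- exact: (measurableC (mB n)).
- rewrite probability_setC; last exact: (mB n).
  move: Bn (measure_ge0 (iid P n.+1) (B n)).
  case: (iid P n.+1 (B n)) => [b| |]; rewrite ?leey//.
  by move=> bp _; rewrite lte_fin in bp; rewrite -EFinB lee_fin; lra.
- by apply: (le_trans _ Uq); apply: le_iid => x; exact: BU.
Qed.

End change_of_measure.

Lemma lne_rate_le_expR (R : realType) (m : \bar R) (a s : R) :
  0 < a -> (0 <= m)%E ->
  ((a^-1)%:E * lne m < (- s)%:E)%E -> (m <= (expR (- (a * s)))%:E)%E.
Proof.
move=> a0; case: m => [m| |]//=.
- rewrite lee_fin => m0; case: ifPn => [m0' _|].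
    by rewrite lee_fin (le_trans m0')// expR_ge0.
  rewrite -ltNge => {}m0; rewrite -EFinM lte_fin lee_fin => /ltW.
  rewrite ler_pdivrMl// mulrN => h; rewrite -[leLHS](lnK m0) ler_expR//.
- by rewrite gt0_muley ?lte_fin ?invr_gt0// ltNge leey.
Qed.

Theorem theorem2p7 (R : realType) (Xi : completeMetricType R)
    (hXi : separable_space Xi)
    (Theta : topologicalType) (hTheta : hausdorff_space Theta)
    (Pth : Theta -> probability (borel Xi) R)
    (r alpha : R) (hr : 0 <= r) (halpha : 0 <= alpha <= 1)
    (S : probability (borel Xi) R -> set Theta)
    (hreg : regular S) (hcov : coverage Pth S r alpha) :
  forall Phat : probability (borel Xi) R, DRO Pth r alpha Phat `<=` S Phat.
Proof.
move=> Phat theta [Q [KLr TVr]]; apply: contrapT => nS.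
have nbhsU : nbhs Phat [set P | ~ S P theta].
  have [uhc _ _] := hreg.
  have oV : open (~` [set theta]).
    apply: closed_openC; apply: accessible_closed_set1.
    exact: hausdorff_accessible.
  have SV : S Phat `<=` ~` [set theta] by move=> t St /= tE; apply: nS; rewrite -tE.
  have := uhc Phat _ oV SV.
  by apply: filterS => P SP SPt; exact: (SP theta SPt erefl).
have low := entropy_bound_nbhs hr (KL_le_entropy_bound KLr) nbhsU.
have [cov_pos cov_0] := hcov theta Q TVr.
have [r0|] := ltP 0 r; last first.
  move=> r_le0; have r0 : r = 0 by apply/eqP; rewrite eq_le r_le0.
  have esup_lt : (limn_esup (miss_prob S Q theta) < (expR (- 2) / 2)%:E)%E.
    by rewrite cov_0// lte_fin divr_gt0// expR_gt0.
  (* Here r = 0: with t = 2, p = 1/2 and q = exp(-2)/2 the lower bound would give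
     1 <= ln (3/2), while ln (3/2) <= 1/2. *)
  have half1 : 2^-1 < 1 :> R by lra.
  have [n [/(_ 2 (expR (- 2) / 2)) lown /ltW missn]] :=
    filter_ex (filterI (low _ half1) (limn_esup_lt esup_lt)).
  have := lown (ler0n _ _) missn.
  have := @le_ln1Dx R (expR 2 * (expR (- 2) / 2)).
  rewrite r0 mulr0 add0r mulrA -expRD subrr expR0 => ln_le.
  have : ln (1 + 1 / 2) <= 1 / 2 :> R by apply: ln_le; lra.
  lra.
have [s [rs esup_lt]] : exists s, r < s /\ (limn_esup (fun n =>
    (n.+1%:R^-1)%:E * lne (miss_prob S Q theta n)) < (- s)%:E)%E.
  move: (cov_pos r0); case: (limn_esup _) => [L| |]//.
  - rewrite lte_fin => Lr; exists ((r - L) / 2); split; first by lra.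
    rewrite lte_fin; lra.
  - by move=> _; exists (r + 1); split; [lra|rewrite ltNye].
have s0 : 0 < s by exact: lt_trans rs.
(* This p is chosen so that s p is the midpoint of r and s; with t = n s the
   excess n (s - r)/2 eventually beats ln 2. *)
have p1 : (r + s) / (2 * s) < 1 by rewrite ltr_pdivrMr ?mulr_gt0//; lra.
have rs0 : 0 < (s - r) / 2 by lra.
have [n [[/(_ (n.+1%:R * s) (expR (- (n.+1%:R * s)))) lown missn] /= nbig]] :=
  filter_ex (filterI (filterI (low _ p1) (limn_esup_lt esup_lt))
    (near_infty_natSinv_lt (PosNum rs0))).
have n0 : 0 < n.+1%:R :> R by [].
have := lown (mulr_ge0 (ltW n0) (ltW s0)) (lne_rate_le_expR n0 (measure_ge0 _ _) missn).
rewrite -expRD subrr expR0.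
have ln2 : ln (1 + 1) <= 1 :> R := le_ln1Dx (lt_trans (ltrN10 R) ltr01).
have -> : n.+1%:R * s * ((r + s) / (2 * s)) = n.+1%:R * r + n.+1%:R * ((s - r) / 2).
  by field; rewrite gt_eqF.
have : 1 < n.+1%:R * ((s - r) / 2) by rewrite -ltr_pdivrMl// mulr1.
lra.
Qed.
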